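(* Let $R$ be a Baer $*$-ring. For any $x,y\in R$ there is a projection $p\in\{x,y\}'$ such that $(px,py)$ is a compatible pair and $((1-p)x,(1-p)y)$ is completely non compatible.
   Context: A Baer $*$-ring is a ring $R$ with unity $1$ and an involution $*$ such that the right annihilator of every subset of $R$ is a principal right ideal generated by a projection (self-adjoint idempotent). Projections are ordered by $p\le q$ iff $pq=p$. For $x\in R$, $[x]$ denotes the left projection of $x$: the smallest projection $e$ with $ex=x$. For $T\subset R$, $T'$ is the commutant of $T$. A pair $(x,y)$ is compatible if $[x^m][y^n]=[y^n][x^m]$ for all $m,n\ge 1$. For a projection $p$ commuting with $x,y$, the compressions $px,py$ are regarded as elements of the corner $pRp$ (with unity $p$). The pair $((1-p)x,(1-p)y)$ is completely non compatible if for every nonzero projection $r\le 1-p$ commuting with $(1-p)x$ and $(1-p)y$, the pair $(rx,ry)$ is not compatible. *)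

(* Defs.v *)
From HB Require Import structures.
From mathcomp Require Import all_boot all_algebra.
From mathcomp Require Import boolp classical_sets.
Set Implicit Arguments.
Unset Strict Implicit.
Unset Printing Implicit Defensive.
Import GRing.Theory.
Local Open Scope classical_set_scope.
Local Open Scope ring_scope.

HB.mixin Record PzRing_isStarRing R of GRing.PzRing R := {
  star : R -> R;
  starK : involutive star;
  starD : {morph star : a b / a + b};
  starM : forall a b, star (a * b) = star b * star a
}.

#[short(type="starRingType")]
HB.structure Definition StarRing := {R of GRing.PzRing R & PzRing_isStarRing R}.

Section StarRingDefs.
Variable R : starRingType.
Implicit Types (p q r e f a b : R) (S T : set R).

Definition projection e : Prop := e * e = e /\ star e = e.

Definition proj_le p q : Prop := p * q = p.

Definition right_annihilator S : set R := [set a | forall s, S s -> s * a = 0].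

Definition commutant T : set R := [set a | forall t, T t -> a * t = t * a].

Definition corner p : set R := [set p * a * p | a in setT].

End StarRingDefs.

HB.mixin Record StarRing_isBaer R of StarRing R := {
  baer_axiom : forall S : set R, exists e : R,
    projection e /\ right_annihilator S = [set e * a | a in setT]
}.

#[short(type="baerStarRingType")]
HB.structure Definition BaerStarRing := {R of StarRing R & StarRing_isBaer R}.

Section Compatibility.
Variable R : baerStarRingType.
Implicit Types (p q r e f a b : R).

(* Notions relative to the corner [p R p], whose unity is [p]; the ring [R]
   itself is the case [p = 1]. *)

Definition is_left_proj p a e : Prop :=
  [/\ projection e, corner p e, e * a = a &
      forall f, projection f -> corner p f -> f * a = a -> proj_le e f].

(* The default value [0] is never used for [a] in the corner of a projection
   [p], by [left_projP] below. *)
Definition left_proj p a : R := xget 0 [set e | is_left_proj p a e].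

(* Powers with exponent at least 1 are the same in [p R p] as in [R]. *)
Definition compatible p a b : Prop :=
  forall m n : nat, (1 <= m)%N -> (1 <= n)%N ->
    left_proj p (a ^+ m) * left_proj p (b ^+ n) =
    left_proj p (b ^+ n) * left_proj p (a ^+ m).

(* For [a], [b] in the corner [q R q]. If [a = q * x] and [proj_le r q], then
   [r * a = r * x]. *)
Definition completely_non_compatible q a b : Prop :=
  forall r, projection r -> r <> 0 -> proj_le r q ->
    r * a = a * r -> r * b = b * r -> ~ compatible r (r * a) (r * b).

Lemma cornerP p a : projection p -> corner p a <-> p * a = a /\ a * p = a.
Proof.
move=> [pp _]; split=> [[c _ <-]|[pa ap]].
  by rewrite !mulrA pp -(mulrA (p * c)) pp.
by exists a; rewrite // pa ap.
Qed.

Lemma is_left_proj_uniq p a e f :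
  is_left_proj p a e -> is_left_proj p a f -> e = f.
Proof.
move=> [pe ce ea le] [pf cf fa lf].
have ef := le f pf cf fa; have fe := lf e pe ce ea.
by case: pe pf => _ se [_ sf]; rewrite -se -ef starM se sf.
Qed.

Lemma left_projP p a :
  projection p -> corner p a -> is_left_proj p a (left_proj p a).
Proof.
move=> pp /(cornerP _ pp)[pa ap].
suff [e He] : exists e, is_left_proj p a e.
  by rewrite /left_proj; case: xgetP => [_ _ //|/(_ e)].
have star0 : star 0 = 0 :> R by apply: (addrI (star 0)); rewrite -starD !addr0.
have starN b : star (- b) = - star b.
  by apply: (addrI (star b)); rewrite -starD !subrr star0.
have star1 : star 1 = 1 :> R by rewrite -[LHS]mulr1 -{2}[1]starK -starM mulr1 starK.
have [g [[gg sg] Hg]] := baer_axiom [set star a].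
have kill f : projection f -> f * a = a -> (1 - g) * f = 1 - g.
  move=> [ff sf] fa.
  have : right_annihilator [set star a] (1 - f).
    move=> _ ->; apply: (can_inj (@starK R)).
    by rewrite starM starK starD starN star1 sf mulrBl mul1r fa subrr star0.
  rewrite Hg => -[c _ Hc].
  have : (1 - g) * (1 - f) = 0 by rewrite -Hc mulrA mulrBl mul1r gg subrr mul0r.
  by rewrite mulrBr mulr1 => /eqP; rewrite subr_eq0 => /eqP.
have ga : g * a = 0.
  have : right_annihilator [set star a] g by rewrite Hg; exists 1; rewrite ?mulr1.
  move=> /(_ _ erefl) H; apply: (can_inj (@starK R)).
  by rewrite starM sg H star0.
have pe : projection (1 - g).
  by split; rewrite ?starD ?starN ?star1 ?sg // mulrBr mulr1 mulrBl mul1r gg subrr subr0.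
have ep := kill p pp pa.
exists (1 - g); split=> //.
- apply/(cornerP _ pp); split=> //.
  by case: (pe) (pp) => _ se [_ sp]; rewrite -{1}se -{1}sp -starM ep se.
- by rewrite mulrBl mul1r ga subr0.
- by move=> f pf _ /(kill f pf).
Qed.

End Compatibility.

(* Main.v *)
Require Import Defs.
From HB Require Import structures.
From mathcomp Require Import all_boot all_algebra.
From mathcomp Require Import boolp classical_sets.
Set Implicit Arguments.
Unset Strict Implicit.
Unset Printing Implicit Defensive.
Import GRing.Theory.
Local Open Scope classical_set_scope.
Local Open Scope ring_scope.

(** Write [[a]] for the left projection of [a] in [R]. A projection [r]
    commuting with [a] also commutes with [[a]], and the left projection of
    [r * a] in the corner of [r] is [r * [a]] ([left_proj_compress]). Hence,
    for [r] commuting with [x] and [y], the pair [(r x, r y)] is compatible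
    exactly when [r] annihilates every commutator
    [c = [x^m][y^n] - [y^n][x^m]], with [m, n >= 1] ([compatible_compress]).
    The theorem therefore asks for a largest projection among those that
    commute with [x] and [y] and annihilate all these [c].

    The Baer axiom provides it. Let [M] be the set of elements commuting with
    every projection of [{x, y}']; it is closed under products and contains
    [1], [x], [y], their adjoints and every [c]. Let [p] generate the right annihilator of the
    set of products [c m] with [m] in [M]. This annihilator is stable under
    left multiplication by [M], so [p] commutes with [x] and [y]
    ([invariant_proj_comm]), and [m = 1] gives [c p = 0]. Conversely, if a
    projection [r] of [{x, y}'] annihilates all the [c], then
    [c m r = r c m = 0], so that [r <= p]; if moreover [r <= 1 - p], then
    [r = 0]. *)

Section StarRingTheory.
Variable R : starRingType.
Implicit Types (a b e p q r : R).

Lemma star0 : star 0 = 0 :> R.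
Proof. by apply: (addrI (star 0)); rewrite -starD !addr0. Qed.

Lemma starN a : star (- a) = - star a.
Proof. by apply: (addrI (star a)); rewrite -starD !subrr star0. Qed.

Lemma star1 : star 1 = 1 :> R.
Proof. by rewrite -[LHS]mulr1 -{2}[1]starK -starM mulr1 starK. Qed.

Lemma projection1 : projection (1 : R).
Proof. by split; rewrite ?mulr1 ?star1. Qed.

Lemma projectionC p : projection p -> projection (1 - p).
Proof.
move=> [pp sp]; split; first by rewrite mulrBr mulr1 mulrBl mul1r pp subrr subr0.
by rewrite starD starN star1 sp.
Qed.

Lemma projectionM p q :
  projection p -> projection q -> GRing.comm p q -> projection (p * q).
Proof.
move=> [pp sp] [qq sq] pq; split; last by rewrite starM sp sq pq.
by rewrite mulrA -(mulrA p) -pq mulrA pp -mulrA qq.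
Qed.

Lemma proj_comm_star p a :
  projection p -> GRing.comm p a -> GRing.comm p (star a).
Proof.
by move=> [_ sp] /(congr1 (@star R)); rewrite !starM sp => H; apply/esym.
Qed.

(** The analogue for a projection of the fact that a subspace stable under an
    operator and its adjoint reduces the operator: the adjoint of the second
    relation is [p a p = p a], to be compared with the first. *)
Lemma invariant_proj_comm p a :
  projection p -> p * (a * p) = a * p -> p * (star a * p) = star a * p ->
  GRing.comm p a.
Proof.
move=> [_ sp] pap /(congr1 (@star R)).
by rewrite !starM starK sp -mulrA pap => /esym.
Qed.

Lemma proj_exp p m : projection p -> (1 <= m)%N -> p ^+ m = p.
Proof.
move=> [pp _]; case: m => // m _.
by elim: m => [|m IH]; rewrite ?expr1 // exprS IH.
Qed.

End StarRingTheory.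

Section CompressedPair.
Variable R : baerStarRingType.
Implicit Types (a b e f p q r x y : R).

Lemma left_proj1P a : is_left_proj 1 a (left_proj 1 a).
Proof.
apply: left_projP; first exact: projection1.
by exists a; rewrite // mul1r mulr1.
Qed.

Lemma left_proj_proj a : projection (left_proj 1 a).
Proof. by case: (left_proj1P a). Qed.

Lemma left_proj_mul a : left_proj 1 a * a = a.
Proof. by case: (left_proj1P a). Qed.

Lemma left_proj_min a f :
  projection f -> f * a = a -> left_proj 1 a * f = left_proj 1 a.
Proof.
case: (left_proj1P a) => _ _ _ le pf; apply: le => //.
by exists f; rewrite // mul1r mulr1.
Qed.

(** Minimality among projections only compares [[a]] with projections; the
    Baer axiom extends it to all elements, because the annihilator of the
    adjoint of [a] is itself generated by a projection. *)
Lemma left_proj_annihil a b : star a * b = 0 -> left_proj 1 a * b = 0.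
Proof.
move=> ab; have [g [pg Hg]] := baer_axiom [set star a].
have [gg sg] := pg.
have ga : g * a = 0.
  have : right_annihilator [set star a] g by rewrite Hg; exists 1; rewrite ?mulr1.
  move=> /(_ _ erefl) H; apply: (can_inj (@starK R)).
  by rewrite starM sg H star0.
have : right_annihilator [set star a] b by move=> _ ->.
rewrite Hg => -[c _ <-].
have := left_proj_min (projectionC pg) (_ : (1 - g) * a = a).
rewrite mulrBl mul1r ga subr0 => /(_ erefl) <-.
by rewrite -mulrA [(1 - g) * _]mulrA mulrBl mul1r gg subrr mul0r mulr0.
Qed.

(** The elements killed by the adjoint of [a] are killed by [[a]], and [r]
    preserves this set, which contains [1 - [a]]. *)
Lemma left_proj_comm r a :
  projection r -> GRing.comm r a -> GRing.comm r (left_proj 1 a).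
Proof.
move=> pr ra; set e := left_proj 1 a.
have [_ se] : projection e := left_proj_proj a.
have : e * (r * (1 - e)) = 0.
  apply: left_proj_annihil; rewrite mulrA -(proj_comm_star pr ra) -mulrA.
  by rewrite mulrBr mulr1 -{1}se -starM left_proj_mul subrr mulr0.
rewrite mulrBr mulr1 mulrBr => /eqP; rewrite subr_eq0 => /eqP er.
(* The right-hand side of [er] is self-adjoint, hence so is [e * r]. *)
have := congr1 (@star R) er; case: pr => _ sr.
by rewrite !starM se sr -mulrA -er.
Qed.

(** If [f] is a projection of the corner of [r] fixing [r * a], then
    [f + (1 - r)] is a projection fixing [a], hence lies above [[a]]. *)
Lemma left_proj_compress r a :
  projection r -> GRing.comm r a -> left_proj r (r * a) = r * left_proj 1 a.
Proof.
move=> pr ra; have [rr sr] := pr.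
have re := left_proj_comm pr ra.
set e := left_proj 1 a in re *.
have pe : projection e := left_proj_proj a.
have cra : corner r (r * a).
  by apply/(cornerP _ pr); split; rewrite ?mulrA ?rr // -mulrA -ra mulrA rr.
apply: (is_left_proj_uniq (left_projP pr cra)); split.
- exact: projectionM.
- by apply/(cornerP _ pr); split; rewrite ?mulrA ?rr // -mulrA -re mulrA rr.
- by rewrite mulrA -(mulrA r) -re mulrA rr -mulrA left_proj_mul.
move=> f pf /(cornerP _ pr) [rf fr] fra; have [ff sf] := pf.
have pg : projection (f + (1 - r)).
  split; last by rewrite !starD starN star1 sf sr.
  rewrite mulrDl !mulrDr !mulrN !mulrBl !mul1r !mulr1 ff fr rf rr.
  by rewrite !subrr oppr0 !addr0 add0r.
have ga : (f + (1 - r)) * a = a.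
  by rewrite mulrDl mulrBl mul1r -{1}fr -mulrA fra [LHS]addrC subrK.
have ef : e * f = e * r.
  apply: (addIr (e - e * r)); rewrite [RHS]addrC subrK.
  by rewrite -[e in e - _]mulr1 -mulrBr -mulrDr left_proj_min.
by rewrite /proj_le -mulrA ef -re mulrA rr.
Qed.

Lemma compatible_compress r x y :
  projection r -> GRing.comm r x -> GRing.comm r y ->
  compatible r (r * x) (r * y) <->
  forall m n : nat, (1 <= m)%N -> (1 <= n)%N ->
    r * (left_proj 1 (x ^+ m) * left_proj 1 (y ^+ n)
         - left_proj 1 (y ^+ n) * left_proj 1 (x ^+ m)) = 0.
Proof.
move=> pr rx ry; have [rr _] := pr.
have lpX z k : GRing.comm r z -> (1 <= k)%N ->
    left_proj r ((r * z) ^+ k) = r * left_proj 1 (z ^+ k).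
  move=> rz k1; rewrite exprMn_comm // proj_exp // left_proj_compress //.
  exact: commrX.
have rL z k : GRing.comm r z -> GRing.comm r (left_proj 1 (z ^+ k)).
  by move=> rz; apply: left_proj_comm => //; apply: commrX.
have factor e f : GRing.comm r e -> r * e * (r * f) = r * (e * f).
  by move=> re; rewrite mulrA -(mulrA r) -re mulrA rr mulrA.
split=> H m n m1 n1.
  have := H m n m1 n1; rewrite !lpX // !factor; [|exact: rL..].
  by rewrite mulrBr => ->; rewrite subrr.
rewrite !lpX // !factor; [|exact: rL..].
by apply/eqP; rewrite -subr_eq0 -mulrBr H.
Qed.

End CompressedPair.

(** This set stands in for the monoid generated by [x], [y] and their adjoints:
    it has the same closure properties, and membership is checked without
    handling words. *)
Definition proj_bicommutant (R : starRingType) (x y : R) : set R :=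
  [set m | forall r : R, projection r -> GRing.comm r x -> GRing.comm r y ->
           GRing.comm r m].

(** The right annihilator of [C] alone is generated by a projection that need
    not commute with [x] and [y]. Multiplying the elements of [C] on the right
    by [proj_bicommutant x y] makes the annihilator stable under [x], [y] and
    their adjoints, and excludes no projection [r] as in the last clause,
    because [r] commutes with all the factors. *)
Lemma largest_annihilating_proj (R : baerStarRingType) (x y : R) (C : set R) :
  C `<=` proj_bicommutant x y ->
  exists p : R,
    [/\ projection p, GRing.comm p x, GRing.comm p y,
        forall c, C c -> p * c = 0 &
        forall r, projection r -> GRing.comm r x -> GRing.comm r y ->
          (forall c, C c -> r * c = 0) -> proj_le r p].
Proof.
move=> CM; set M := proj_bicommutant x y.
have [p [pp Hp]] := baer_axiom [set s | exists c m, [/\ C c, M m & s = c * m]].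
set A := right_annihilator _ in Hp; have [pp2 sp] := pp.
have Ap : A p by rewrite Hp; exists 1; rewrite ?mulr1.
have fixA a : A a -> p * a = a by rewrite Hp => -[b _ <-]; rewrite mulrA pp2.
have stable m : M m -> p * (m * p) = m * p.
  move=> Mm; apply: fixA => _ [c [k [Cc Mk ->]]].
  rewrite mulrA; apply: Ap; exists c, (k * m); split; rewrite ?mulrA //.
  by move=> r pr rx ry; apply: commrM; [apply: Mk | apply: Mm].
have px : GRing.comm p x.
  apply: invariant_proj_comm => //; apply: stable => r pr rx ry //.
  exact: proj_comm_star.
have py : GRing.comm p y.
  apply: invariant_proj_comm => //; apply: stable => r pr rx ry //.
  exact: proj_comm_star.
exists p; split=> // [c Cc | r pr rx ry rC].
  rewrite (CM c Cc p pp px py); apply: Ap; exists c, 1; split=> //.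
    by move=> *; apply: commr1.
  by rewrite mulr1.
have pr_r : p * r = r.
  apply: fixA => _ [c [m [Cc Mm ->]]].
  rewrite -mulrA -(Mm r pr rx ry) mulrA -(CM c Cc r pr rx ry).
  by rewrite rC // mul0r.
by case: pr => _ sr; rewrite /proj_le -{1}sr -{1}sp -starM pr_r.
Qed.

Theorem theorem3p6 (R : baerStarRingType) (x y : R) :
  exists p : R,
    [/\ projection p,
        commutant [set x; y] p,
        compatible p (p * x) (p * y) &
        completely_non_compatible (1 - p) ((1 - p) * x) ((1 - p) * y)].
Proof.
pose c m n := left_proj 1 (x ^+ m) * left_proj 1 (y ^+ n)
              - left_proj 1 (y ^+ n) * left_proj 1 (x ^+ m).
pose C := [set d | exists m n, [/\ (1 <= m)%N, (1 <= n)%N & d = c m n]].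
have CM : C `<=` proj_bicommutant x y.
  move=> _ [m [n [_ _ ->]]] r pr rx ry.
  by apply: commrB; apply: commrM; apply: left_proj_comm => //; apply: commrX.
have [p [pp px py pC pmax]] := largest_annihilating_proj CM.
exists p; split=> //; first by move=> _ [->|->].
  apply/compatible_compress => // m n m1 n1.
  by apply: pC; exists m, n.
move=> r pr r0 rle; have rq : r * (1 - p) = r by [].
have qr : (1 - p) * r = r.
  have [_ sq] := projectionC pp; case: pr => _ sr.
  by rewrite -{1}sr -{1}sq -starM rq.
have commr z : GRing.comm p z -> r * ((1 - p) * z) = (1 - p) * z * r ->
    GRing.comm r z.
  move=> pz; have qz : (1 - p) * z = z * (1 - p).
    by rewrite mulrBl mulrBr mul1r mulr1 pz.
  by rewrite {2}qz mulrA rq -mulrA qr.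
move=> /(commr x px) rx /(commr y py) ry; rewrite !mulrA rq.
move=> /(compatible_compress pr rx ry) H; apply: r0.
have rp : r * p = r by apply: pmax => // _ [m [n [m1 n1 ->]]]; apply: H.
by rewrite -rq mulrBr mulr1 rp subrr.
Qed.
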